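(* Let $w=w(x_1,\dots,x_r)$ be a group-word in $r$ variables, let $x_0$ be a variable distinct from $x_1,\dots,x_r$, and let $w'=[w,x_0]$, regarded as a word in the $r+1$ variables $x_0,x_1,\dots,x_r$. (i) If $w$ is weakly rational, then $w'$ is weakly rational. (ii) If $w$ is rational, then $w'$ is rational.
   Context: A group-word $w=w(x_1,\dots,x_k)$ is an element of the free group on $x_1,\dots,x_k$. For a group $G$, $G_w$ denotes the set of all values $w(g_1,\dots,g_k)$ with $g_1,\dots,g_k\in G$. The commutator is $[a,b]=a^{-1}b^{-1}ab$. The word $w$ is called weakly rational if for every finite group $G$, every $g\in G$, and every integer $e$ relatively prime to $|G|$, one has $g\in G_w$ if and only if $g^e\in G_w$. The word $w$ is called rational if for every finite group $G$, every $g\in G$, and every integer $e$ relatively prime to $|G|$, the number of $k$-tuples $(x_1,\dots,x_k)\in G^k$ with $w(x_1,\dots,x_k)=g$ equals the number of $k$-tuples with $w(x_1,\dots,x_k)=g^e$. Here $k$ is the number of variables of the word. *)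

(* Defs.v *)
From HB Require Import structures.
From mathcomp Require Import all_boot all_fingroup all_algebra.

Set Implicit Arguments.
Unset Strict Implicit.
Unset Printing Implicit Defensive.

Local Open Scope group_scope.

(* The free group on T is realised as the set of reduced words over T and its *)
(* formal inverses: the letter (x, false) stands for x, (x, true) for x^-1.   *)
Section FreeGroup.

Variable T : choiceType.

Definition letter := (T * bool)%type.

Implicit Types (a b : letter) (s t : seq letter).

Definition letter_inv a : letter := (a.1, ~~ a.2).

Definition reduced s := sorted (fun a b => b != letter_inv a) s.

Definition push a s :=
  if s is b :: t then if b == letter_inv a then t else a :: s else [:: a].

Record free_group := FreeGroup { free_word :> seq letter; _ : reduced free_word }.

HB.instance Definition _ := [isSub for free_word].
HB.instance Definition _ := [Choice of free_group by <:].

Implicit Types u v : free_group.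

Lemma letter_invK : involutive letter_inv.
Proof. by case=> x b; rewrite /letter_inv /= negbK. Qed.

Lemma reduced_behead a s : reduced (a :: s) -> reduced s.
Proof. exact: path_sorted. Qed.

Lemma push_reduced a s : reduced s -> reduced (push a s).
Proof.
case: s => [|b s] //= red_bs; case: ifPn => [_|neq_b] /=.
  exact: path_sorted red_bs.
by rewrite neq_b.
Qed.

Lemma pushK a s : reduced s -> push a (push (letter_inv a) s) = s.
Proof.
case: s => [|b s] /=; first by rewrite eqxx.
rewrite letter_invK; have [->{b} | _ _] := eqVneq; last by rewrite /= eqxx.
by case: s => [|c s] //= /andP[/negPf-> _].
Qed.

Lemma push_cons a s : reduced (a :: s) -> push a s = a :: s.
Proof. by case: s => [|b s] //= /andP[/negPf-> _]. Qed.

Lemma foldr_push_reduced s t : reduced t -> reduced (foldr push t s).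
Proof. by move=> red_t; elim: s => //= a s; apply: push_reduced. Qed.

Lemma foldr_push_push a s t :
  reduced t -> foldr push t (push a s) = push a (foldr push t s).
Proof.
move=> red_t; case: s => [|b s] //=; have [->{b} | _] := eqVneq b _; last by [].
by rewrite pushK // foldr_push_reduced.
Qed.

Lemma foldr_push_nil s : reduced s -> foldr push [::] s = s.
Proof.
elim: s => //= a s IHs red_as.
by rewrite IHs ?push_cons //; apply: reduced_behead red_as.
Qed.

Lemma reduced_inv s : reduced s -> reduced (rev (map letter_inv s)).
Proof.
rewrite /reduced rev_sorted sorted_map; apply: sub_sorted => a b /=.
by rewrite letter_invK eq_sym.
Qed.

Definition free_one : free_group := FreeGroup (isT : reduced [::]).

(* foldr push v u is the reduced form of u ++ v.                              *)
Definition free_mul u v : free_group :=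
  FreeGroup (foldr_push_reduced u (valP v)).

Definition free_inv u : free_group := FreeGroup (reduced_inv (valP u)).

Lemma free_mulA : associative free_mul.
Proof.
move=> u v w; apply: val_inj => /=.
by elim: (val u) => //= a s ->; rewrite foldr_push_push //; apply: valP.
Qed.

Lemma free_mul1g : left_id free_one free_mul.
Proof. by move=> u; apply: val_inj. Qed.

Lemma free_mulg1 : right_id free_one free_mul.
Proof. by move=> u; apply: val_inj; apply: foldr_push_nil (valP u). Qed.

Lemma foldr_push_invK s t :
  reduced t -> foldr push (foldr push t s) (rev (map letter_inv s)) = t.
Proof.
move=> red_t; elim: s => //= a s IHs; rewrite rev_cons foldr_rcons.
by rewrite -[X in push _ (push X _)]letter_invK pushK // foldr_push_reduced.
Qed.

Lemma free_mulVg : left_inverse free_one free_inv free_mul.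
Proof.
move=> u; apply: val_inj; rewrite /= -[X in foldr _ X]foldr_push_nil ?(valP u) //.
exact: foldr_push_invK.
Qed.

Lemma free_invK : involutive free_inv.
Proof.
move=> u; apply: val_inj; rewrite /= map_rev revK -map_comp.
by rewrite map_id_in // => a _ /=; rewrite letter_invK.
Qed.

Lemma free_mulgV : right_inverse free_one free_inv free_mul.
Proof. by move=> u; rewrite -{1}[u]free_invK free_mulVg. Qed.

HB.instance Definition _ :=
  isGroup.Build free_group free_mulA free_mul1g free_mulg1 free_mulVg free_mulgV.

Definition free_gen (x : T) : free_group :=
  FreeGroup (isT : reduced [:: (x, false)]).

Section Lift.

Variables (G : groupType) (f : T -> G).

Definition letter_val a : G := if a.2 then (f a.1)^-1 else f a.1.

Definition free_lift u : G := \prod_(a <- val u) letter_val a.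

Lemma letter_valV a : letter_val (letter_inv a) = (letter_val a)^-1.
Proof. by case: a => x [] //=; rewrite /letter_val /= invgK. Qed.

Lemma prod_push a s :
  \prod_(b <- push a s) letter_val b = letter_val a * \prod_(b <- s) letter_val b.
Proof.
case: s => [|b s] /=; first by rewrite big_seq1 big_nil mulg1.
by have [->|_] := eqVneq; rewrite !big_cons // letter_valV mulKVg.
Qed.

Lemma free_lift_morphism : monoid_morphism free_lift.
Proof.
split=> [|u v]; first by rewrite /free_lift big_nil.
rewrite /free_lift /=; elim: (val u) => [|a s IHs] /=.
  by rewrite big_nil mul1g.
by rewrite prod_push IHs big_cons mulgA.
Qed.

HB.instance Definition _ :=
  isUMagmaMorphism.Build free_group G free_lift free_lift_morphism.

Lemma free_lift_gen x : free_lift (free_gen x) = f x.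
Proof. by rewrite /free_lift big_seq1. Qed.

End Lift.

End FreeGroup.

(* Words in k variables; the variables are indexed from 0.                    *)
Definition word k := free_group 'I_k.

Definition expgz (G : groupType) (x : G) (e : int) : G :=
  match e with Posz n => x ^+ n | Negz n => x ^- n.+1 end.

Section WordMaps.

Variables (k : nat) (w : word k) (gT : finGroupType) (G : {group gT}).

Definition word_value (x : {ffun 'I_k -> gT}) : gT := free_lift x w.

Definition word_values : {set gT} :=
  [set word_value x | x in ffun_on (mem G)].

Definition word_fiber (g : gT) : {set {ffun 'I_k -> gT}} :=
  [set x in ffun_on (mem G) | word_value x == g].

End WordMaps.

Definition weakly_rational k (w : word k) : Prop :=
  forall (gT : finGroupType) (G : {group gT}) (g : gT) (e : int),
    g \in G -> coprimez e #|G| ->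
    (g \in word_values w G <-> expgz g e \in word_values w G).

Definition rational k (w : word k) : Prop :=
  forall (gT : finGroupType) (G : {group gT}) (g : gT) (e : int),
    g \in G -> coprimez e #|G| ->
    #|word_fiber w G g| = #|word_fiber w G (expgz g e)|.

(* x_i is sent to x_(i+1), so that x_0 becomes a fresh variable.              *)
Definition word_shift r (w : word r) : word r.+1 :=
  free_lift (fun i : 'I_r => free_gen (lift ord0 i)) w.

Definition word_comm r (w : word r) : word r.+1 :=
  [~ word_shift w, free_gen ord0].

(* Main.v *)
Require Import Defs.
From mathcomp Require Import all_boot all_fingroup all_algebra.
From mathcomp Require Import all_solvable all_field all_character.

Set Implicit Arguments.
Unset Strict Implicit.
Unset Printing Implicit Defensive.

Import GroupScope GRing.Theory Num.Theory.

(** Fix a finite group G and an exponent k coprime to its order. For a in G, let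
T(a, g) be the number of pairs (h, z) in G x G with (a^-1)^h * a^z = g.
Frobenius' formula expresses T(a, g) as #|G| times the sum over the
irreducible characters chi of chi(a^-1) chi(a) chi(g)^* / chi(1). A field
automorphism u of the algebraic numbers that raises the #|G|-th roots of unity
to the power k sends every chi(x) to chi(x^k), so that applying u to this
formula gives T(a^k, g^k) = u(T(a, g)), and the right-hand side is T(a, g)
because it is a natural number ([card_conj_mul_fiberX], for products of
conjugates of any two elements).

A commutator [a, y] is the product a^-1 * a^y. Hence T(a, g) is the sum, over
the conjugates of a by the elements of G, of the number of y in G for which
the commutator with y is g. If a weight n on G is constant on conjugacy
classes, then the number of solutions of [a, y] = g, summed over a with weight
n(a), is 1/#|G| times the sum of n(a) T(a, g) over a in G; if moreover
n(a^k) = n(a), the substitution of a^k for a shows that this sum is the same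
for g and g^k ([weighted_comm_countX]).

The fiber of [w, x_0] over g is counted by such a sum, n(a) being the size of
the fiber of w over a ([card_word_comm_fiber]). This size is invariant under
conjugation for every w, and under a |-> a^k when w is rational, which gives
the second claim. For the first one, only the positivity of the sum matters, and
this does not change when n(a) is replaced by the indicator of the set of values
of w ([mem_word_comm_values]), which is invariant under a |-> a^k
when w is weakly rational. *)

(** * Characters and powers *)

Section CharacterPowers.

Variables (gT : finGroupType) (G : {group gT}) (k : nat).
Variable u : {rmorphism algC -> algC}.
Hypothesis u_root : forall z, (z ^+ #|G| = 1 -> u z = z ^+ k)%R.

(** The restriction of chi to the cyclic group <[x]> is a sum of linear
characters, whose values are roots of unity on which u is known. *)
Lemma char_expgn (chi : 'CF(G)) x :
  chi \is a character -> x \in G -> chi (x ^+ k) = u (chi x).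
Proof.
move=> Nchi Gx; have sXG : <[x]> \subset G by rewrite cycle_subG.
rewrite -!(cfResE chi sXG) ?mem_cycle ?cycle_id //.
have [r ->] := char_sum_irr (cfRes_char <[x]> Nchi).
rewrite !sum_cfunE rmorph_sum; apply: eq_bigr => i _.
have lin_i := char_abelianP _ (cycle_abelian x) i.
rewrite lin_charX ?cycle_id // u_root // -lin_charX ?cycle_id //.
by rewrite expg_cardG ?lin_char1.
Qed.

End CharacterPowers.

(** * Products of conjugates *)

Section ConjugateProducts.

Variables (gT : finGroupType) (G : {group gT}).
Implicit Types (a b g x : gT).

Definition conj_mul_fiber a b g : {set gT * gT} :=
  [set p in setX G G | a ^ p.1 * b ^ p.2 == g].

(** The conjugators of a into x form a right coset of the centraliser of a. *)
Lemma card_conjugators a x :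
  a \in G -> x \in a ^: G -> #|[set h in G | a ^ h == x]| = #|'C_G[a]|.
Proof.
move=> Ga /imsetP[h0 Gh0 ->]; rewrite -[RHS](card_rcoset _ h0); apply: eq_card => h.
rewrite mem_rcoset !inE groupMr ?groupV //; apply: andb_id2l => _.
by rewrite conjg_set1 sub1set inE conjgM (can2_eq (conjgKV h0) (conjgK h0)).
Qed.

Lemma card_conj_mul_fiber a b g :
  a \in G -> b \in G ->
  #|conj_mul_fiber a b g|
    = (#|gring_classM_coef_set (a ^: G) (b ^: G) g| * (#|'C_G[a]| * #|'C_G[b]|))%N.
Proof.
move=> Ga Gb.
pose f (p : gT * gT) := (a ^ p.1, b ^ p.2).
rewrite -sum1_card (partition_big f
  (mem (gring_classM_coef_set (a ^: G) (b ^: G) g))) /=; last first.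
  move=> [h z]; rewrite !inE /= => /andP[/andP[Gh Gz] ->].
  by rewrite !memJ_class.
rewrite -sum_nat_const; apply: eq_bigr => -[x y].
rewrite !inE /= => /andP[/andP[Kx Ky] /eqP Dg].
rewrite -(card_conjugators Ga Kx) -(card_conjugators Gb Ky) -cardsX sum1_card.
apply: eq_card => -[h z]; rewrite unfold_in !inE /= xpair_eqE.
case: (h \in G); case: (z \in G); rewrite ?andbF //=.
by apply: andb_idl => /andP[/eqP-> /eqP->]; rewrite Dg.
Qed.

(** Counting conjugators instead of elements of the two classes clears the class
sizes from Frobenius' formula for the class multiplication coefficients: only
the factor #|G|, fixed by automorphisms, is left in front of the sum. *)
Lemma frobenius_conj_mul a b g :
  a \in G -> b \in G -> g \in G ->
  (#|conj_mul_fiber a b g|%:R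
     = #|G|%:R * \sum_i 'chi[G]_i a * 'chi_i b * ('chi_i g)^* / 'chi_i 1%g)%R.
Proof.
move=> Ga Gb Gg; rewrite card_conj_mul_fiber //.
have idx x : x \in G -> {i : 'I_#|classes G| | enum_val i = x ^: G}.
  by move=> Gx; exists (enum_rank_in (mem_classes Gx) (x ^: G));
    rewrite enum_rankK_in ?mem_classes.
have [i Di] := idx _ Ga; have [j Dj] := idx _ Gb; have [l Dl] := idx _ Gg.
have Kg : g \in enum_val l by rewrite Dl class_refl.
have /= := @gring_classM_coef_sum_eq _ G i j l a b g.
rewrite (set_gring_classM_coef _ _ Kg) Di Dj Dl !class_refl /=.
move=> DN; rewrite natrM DN // => {DN}.
have cardGa x : (#|G| = #|x ^: G| * #|'C_G[x]|)%N.
  by rewrite -index_cent1 mulnC Lagrange ?subsetIl.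
rewrite mulrAC; congr (_ * _)%R; rewrite mulrAC -natrM mulnACA -!cardGa natrM.
by rewrite mulfK ?neq0CG.
Qed.

(** The left-hand side is the image of the right-hand side, a natural number,
under an automorphism that raises #|G|-th roots of unity to the power k. *)
Lemma card_conj_mul_fiberX a b g k :
  a \in G -> b \in G -> g \in G -> coprime k #|G| ->
  #|conj_mul_fiber (a ^+ k) (b ^+ k) (g ^+ k)| = #|conj_mul_fiber a b g|.
Proof.
move=> Ga Gb Gg /Qn_aut_exists[u Du]; apply/eqP; rewrite -(eqr_nat algC).
rewrite -(rmorph_nat u #|conj_mul_fiber a b g|) !frobenius_conj_mul ?groupX //.
rewrite rmorphM rmorph_nat rmorph_sum; apply/eqP; congr (_ * _)%R.
apply: eq_bigr => i _; rewrite !(char_expgn Du) ?irr_char //.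
rewrite conjC_irrAut fmorph_div !rmorphM; congr (_ / _)%R.
(* u fixes the degree chi(1), being chi(1^k). *)
by rewrite -(char_expgn Du) ?irr_char // expg1n.
Qed.

End ConjugateProducts.

(** * Counting commutators *)

Section CommutatorCount.

Variables (gT : finGroupType) (G : {group gT}).
Implicit Types (a b g h : gT).

Definition comm_fiber a g : {set gT} := [set y in G | [~ a, y] == g].

(** The pairs (h, y) and (h, z) correspond by z = h * y, as
[~ a ^ h, y] = (a^-1) ^ h * a ^ (h * y). *)
Lemma sum_card_comm_fiberJ a g :
  (\sum_(h in G) #|comm_fiber (a ^ h)%g g|)%N = #|conj_mul_fiber G a^-1 a g|.
Proof.
transitivity (\sum_(h in G) \sum_(z in G | (a^-1 ^ h * a ^ z == g)%g) 1)%N; last first.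
  rewrite pair_big_dep /= sum1dep_card; apply: eq_card => -[h z].
  by rewrite !inE andbA.
apply: eq_bigr => h Gh; rewrite -sum1dep_card [RHS](reindex_inj (mulgI h)) /=.
by apply: eq_bigl => y; rewrite groupMl // conjVg conjgM commgEl.
Qed.

Variables (n : gT -> nat) (k : nat).
Hypothesis nJ : {in G &, forall a h, n (a ^ h) = n a}.

(** The number of y with [~ a, y] = g is not a class function of a, but against
a weight which is one, it may be replaced by its mean over the conjugates of a,
which the character formula controls. *)
Lemma weighted_comm_average g :
  (#|G| * (\sum_(a in G) n a * #|comm_fiber a g|)
     = \sum_(a in G) n a * #|conj_mul_fiber G a^-1%g a g|)%N.
Proof.
rewrite -sum_nat_const.
transitivity (\sum_(h in G) \sum_(a in G) n a * #|comm_fiber (a ^ h)%g g|)%N.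
  apply: eq_bigr => h Gh; rewrite (reindex_inj (conjg_inj h)) /=.
  by apply: eq_big => [a | a Ga]; rewrite ?groupJr // nJ // -(groupJr _ Gh).
rewrite exchange_big; apply: eq_bigr => a _.
by rewrite -big_distrr sum_card_comm_fiberJ.
Qed.

Hypothesis co_k : coprime k #|G|.
Hypothesis nX : {in G, forall a, n (a ^+ k) = n a}.

(** The map a |-> a ^+ k permutes G, since k is coprime to its order; it
preserves n and takes the averaged counts for g to those for g ^+ k. *)
Lemma weighted_comm_countX g :
  g \in G ->
  (\sum_(a in G) n a * #|comm_fiber a g|
     = \sum_(a in G) n a * #|comm_fiber a (g ^+ k)%g|)%N.
Proof.
move=> Gg; apply/eqP; rewrite -(eqn_pmul2l (cardG_gt0 G)) !weighted_comm_average.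
have co_Gk : coprime #|G| k by rewrite coprime_sym.
rewrite [eqbRHS](reindex_onto (natexp^~ k) (natexp^~ (expg_invn G k))) /=; last first.
  by move=> a Ga; rewrite -expgM mulnC expgM (expgK co_Gk).
apply/eqP; apply: eq_big => [a | a Ga]; last first.
  by rewrite nX // -expVgn card_conj_mul_fiberX ?groupV.
apply/idP/andP => [Ga | [Gak /eqP <-]]; last by rewrite groupX.
by rewrite groupX // (expgK co_Gk).
Qed.

End CommutatorCount.

(** * Values and fibers of words *)

Lemma free_lift_comp (T S : choiceType) (H : groupType) (f : T -> free_group S)
    (v : S -> H) u :
  free_lift v (free_lift f u) = free_lift (free_lift v \o f) u.
Proof.
rewrite {2 3}/free_lift gmulf_prod; apply: eq_bigr => -[x []] _ //=.
by rewrite /letter_val /= gmulfV.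
Qed.

Lemma eq_free_lift (T : choiceType) (H : groupType) (f1 f2 : T -> H) u :
  f1 =1 f2 -> free_lift f1 u = free_lift f2 u.
Proof.
by move=> eqf; apply: eq_bigr => -[x b] _; rewrite /letter_val /= eqf.
Qed.

Section WordFibers.

Variables (gT : finGroupType) (G : {group gT}).

Lemma mem_word_values k (w : word k) g :
  (g \in word_values w G) = (0 < #|word_fiber w G g|).
Proof.
apply/imsetP/card_gt0P => [[x Gx ->] | [x]].
  by exists x; rewrite inE Gx eqxx.
by rewrite inE => /andP[Gx /eqP <-]; exists x.
Qed.

Lemma word_value_in k (w : word k) x :
  x \in ffun_on (mem G) -> word_value w x \in G.
Proof.
move/ffun_onP=> Gx; apply: group_prod => -[i []] _; rewrite /letter_val /=.
  by rewrite groupV Gx.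
exact: Gx.
Qed.

Lemma word_valueJ k (w : word k) (x : {ffun 'I_k -> gT}) h :
  word_value w [ffun i => x i ^ h] = word_value w x ^ h.
Proof.
rewrite /word_value /free_lift.
rewrite (big_morph (conjg^~ h) (fun a b => conjMg a b h) (conj1g h)).
by apply: eq_bigr => -[i []] _; rewrite /letter_val /= ffunE ?conjVg.
Qed.

Lemma card_word_fiberJ k (w : word k) g h :
  h \in G -> #|word_fiber w G (g ^ h)| = #|word_fiber w G g|.
Proof.
have le_J a y : y \in G -> #|word_fiber w G a| <= #|word_fiber w G (a ^ y)|.
  move=> Gy; pose J (x : {ffun 'I_k -> gT}) := [ffun i => x i ^ y].
  have J_inj : injective J.
    by move=> x1 x2 /ffunP eqJ; apply/ffunP=> i;
      have:= eqJ i; rewrite !ffunE => /conjg_inj.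
  rewrite -(card_imset _ J_inj).
  apply/subset_leq_card/subsetP=> z /imsetP[x Fx ->{z}]; move: Fx.
  rewrite !inE => /andP[/ffun_onP Gx /eqP <-].
  rewrite word_valueJ eqxx andbT; apply/ffun_onP => i.
  by rewrite ffunE groupJ ?Gx.
move=> Gh; apply/eqP; rewrite eqn_leq le_J // andbT.
by have := le_J (g ^ h) _ (groupVr Gh); rewrite conjgK.
Qed.

Definition ffun_cons r (y : gT) (x : {ffun 'I_r -> gT}) : {ffun 'I_r.+1 -> gT} :=
  [ffun i => oapp x y (unlift ord0 i)].

Lemma word_value_comm r (w : word r) y (x : {ffun 'I_r -> gT}) :
  word_value (word_comm w) (ffun_cons y x) = [~ word_value w x, y].
Proof.
rewrite /word_value /word_comm gmulfR /= free_lift_gen free_lift_comp.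
rewrite ffunE unlift_none /=; congr [~ _, y]; apply: eq_free_lift => i /=.
by rewrite free_lift_gen ffunE liftK.
Qed.

Lemma ffun_cons_on r y (x : {ffun 'I_r -> gT}) :
  (ffun_cons y x \in ffun_on (mem G)) = (y \in G) && (x \in ffun_on (mem G)).
Proof.
apply/ffun_onP/andP => [Gyx | [Gy /ffun_onP Gx] i]; last first.
  by rewrite ffunE; case: unliftP => [j|] _ /=; [apply: Gx|].
split; first by have := Gyx ord0; rewrite ffunE unlift_none.
by apply/ffun_onP=> i; have := Gyx (lift ord0 i); rewrite ffunE liftK.
Qed.

Lemma card_word_comm_fiber r (w : word r) g :
  #|word_fiber (word_comm w) G g|
    = (\sum_(a in G) #|word_fiber w G a| * #|comm_fiber G a g|)%N.
Proof.
pose f (p : gT * {ffun 'I_r -> gT}) := ffun_cons p.1 p.2.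
pose f' (z : {ffun 'I_r.+1 -> gT}) := (z ord0, [ffun i => z (lift ord0 i)]).
have fK : cancel f f'.
  move=> [y x]; congr (_, _); first by rewrite ffunE unlift_none.
  by apply/ffunP=> i; rewrite !ffunE liftK.
have f'K : cancel f' f.
  move=> z; apply/ffunP=> i; rewrite !ffunE.
  by case: unliftP => [j|] -> //=; rewrite ffunE.
rewrite -sum1dep_card (reindex f) /=; last by exists f' => ? _.
rewrite (partition_big (fun p : gT * _ => word_value w p.2) (mem G)) /=; last first.
  by move=> [y x] /andP[]; rewrite ffun_cons_on => /andP[_ Gx] _; apply: word_value_in.
apply: eq_bigr => a Ga; rewrite mulnC -cardsX sum1dep_card; apply: eq_card => -[y x].
rewrite in_setX !in_set /f /= ffun_cons_on word_value_comm.
by case: (word_value w x =P a) => [->|]; rewrite ?andbF // !andbT andbAC.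
Qed.

(** Values without multiplicity can still be detected by a weighted commutator
count: a sum of naturals is positive as soon as one term is, whatever the
sizes of the positive weights. *)
Lemma mem_word_comm_values r (w : word r) g :
  (g \in word_values (word_comm w) G)
    = (0 < \sum_(a in G) (a \in word_values w G) * #|comm_fiber G a g|)%N.
Proof.
rewrite mem_word_values card_word_comm_fiber !lt0n !sum_nat_eq0; congr (~~ _).
apply: eq_forallb => a.
by rewrite !muln_eq0 eqb0 mem_word_values lt0n negbK.
Qed.

End WordFibers.

(** As g^-1 = g^(#|G| - 1) and #|G| - 1 is coprime to #|G|, negative exponents
reduce to positive ones, uniformly in g. *)
Lemma expgz_coprime_nat (gT : finGroupType) (G : {group gT}) (e : int) :
  coprimez e #|G| ->
  exists2 k, coprime k #|G| & {in G, forall g, expgz g e = g ^+ k}.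
Proof.
case: e => m co_m; first by exists m.
exists (#|G|.-1 * m.+1)%N => [|g Gg /=].
  by rewrite coprimeMl coprimePn // co_m.
suff -> : g ^- m.+1 = (g ^+ #|G|.-1) ^+ m.+1 by rewrite expgM.
rewrite -expVgn; congr (_ ^+ _); apply: (mulgI g).
by rewrite mulgV -expgS prednK ?expg_cardG.
Qed.

Theorem theorem3 (r : nat) (w : word r) :
  (weakly_rational w -> weakly_rational (word_comm w)) /\
  (rational w -> rational (word_comm w)).
Proof.
split=> rat_w gT G g e Gg co_e; have [k co_k Dk] := expgz_coprime_nat co_e.
all: rewrite Dk //.
  rewrite !mem_word_comm_values.
  rewrite (@weighted_comm_countX _ G (fun a => a \in word_values w G) k) // => a.
    by move=> h Ga Gh; rewrite !mem_word_values card_word_fiberJ.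
  by move=> Ga; congr nat_of_bool; apply/idP/idP => /(rat_w _ G a k Ga co_k).
rewrite !card_word_comm_fiber; apply: weighted_comm_countX => // a.
  by move=> h Ga Gh; rewrite card_word_fiberJ.
by move=> Ga; rewrite [RHS](rat_w _ G a k).
Qed.
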